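(* Let $n\ge 1$ be an integer. As $D$ ranges over all GMPD domains with $|\operatorname{Spec}(D)|=n$, the partially ordered sets $\operatorname{Spec}(D)$ (ordered by inclusion) fall into at most $\lceil \frac{n}{2}\rceil$ isomorphism classes of partially ordered sets.
   Context: All rings are commutative unitary integral domains. $\operatorname{Spec}(D)$ is the set of prime ideals of $D$, partially ordered by inclusion. Two partially ordered sets $U$ and $V$ are isomorphic if there is an order preserving bijection $f:U\to V$ such that $f^{-1}$ is also order preserving. $D$ is h-local if each nonzero ideal of $D$ is contained in only finitely many maximal ideals and each nonzero prime ideal is contained in a unique maximal ideal. An MNI ideal of $D$ is an ideal of $D$ which is maximal (under inclusion) among the non-invertible ideals of $D$ (the zero ideal counts as non-invertible). $D$ is an MPD domain if it has a unique MNI ideal $Q$ and every nonzero non-invertible ideal of $D$ can be written as $JQ$ for some invertible ideal $J$ of $D$. $D$ is a GMPD domain (globalized multiplicatively pinched-Dedekind domain) if $D$ is h-local and the localization $D_M$ is an MPD domain for every maximal ideal $M$ of $D$. *)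

(* Defs.v *)
(* Written with MathComp and MathComp-Analysis (classical sets and
   cardinality). *)
From HB Require Import structures.
From mathcomp Require Import all_boot all_order all_algebra.
From mathcomp Require Import fraction.
From mathcomp Require Import boolp classical_sets functions cardinality.

Set Implicit Arguments.
Unset Strict Implicit.
Unset Printing Implicit Defensive.

Import Order.TTheory GRing.Theory.

Local Open Scope classical_set_scope.
Local Open Scope ring_scope.

Definition poset_iso d d' (U : porderType d) (V : porderType d') : Prop :=
  exists (f : U -> V) (g : V -> U),
    [/\ cancel f g, cancel g f,
        {homo f : x y / (x <= y)%O} & {homo g : x y / (x <= y)%O}].

(* Unlike MathComp's [idealr_closed], this allows the unit ideal. *)
Definition ideal (D : comNzRingType) (I : set D) : Prop :=
  [/\ I 0, forall x y, I x -> I y -> I (x + y)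
    & forall a x, I x -> I (a * x)].

Definition prime_ideal (D : comNzRingType) (P : set D) : Prop :=
  [/\ ideal P, ~ P 1 & forall x y, P (x * y) -> P x \/ P y].

Definition maximal_ideal (D : comNzRingType) (M : set D) : Prop :=
  [/\ ideal M, ~ M 1
    & forall I, ideal I -> ~ I 1 -> M `<=` I -> I = M].

Lemma maximal_prime (D : comNzRingType) (M : set D) :
  maximal_ideal M -> prime_ideal M.
Proof.
move=> [[M0 MD MM] M1 Mmax]; split=> // x y Mxy.
apply: contrapT => /not_orP[nMx nMy].
pose I := [set z | exists m a, M m /\ z = m + a * x].
have II : ideal I.
  split; first by exists 0, 0; rewrite mul0r addr0.
    move=> _ _ [m [a [Mm ->]]] [m' [a' [Mm' ->]]]; exists (m + m'), (a + a').
    by split; [exact: MD | rewrite mulrDl addrACA].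
  move=> b _ [m [a [Mm ->]]]; exists (b * m), (b * a).
  by split; [exact: MM | rewrite mulrDr mulrA].
have MI : M `<=` I by move=> z Mz; exists z, 0; rewrite mul0r addr0.
have Ix : I x by exists 0, 1; rewrite mul1r add0r.
have [[m [a [Mm e]]]|nI1] := pselect (I 1); last first.
  by apply: nMx; rewrite -(Mmax I II nI1 MI).
apply: nMy; rewrite -[y]mul1r e mulrDl -mulrA; apply: MD; last exact: MM.
by rewrite mulrC; exact: MM.
Qed.

Section Spec.
Variable D : comNzRingType.

Record Spec :=
  SpecOf { spec_val :> set D; _ : `[< prime_ideal spec_val >] }.

HB.instance Definition _ := [isSub for spec_val].
HB.instance Definition _ := [Choice of Spec by <:].
(* The order inherited from [set D] is inclusion, see [subsetEset]. *)
HB.instance Definition _ :=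
  [SubChoice_isSubPOrder of Spec by <: with set_display].

Lemma le_specE (P Q : Spec) : (P <= Q)%O = (P `<=` Q) :> Prop.
Proof. by rewrite -subsetEset. Qed.

End Spec.

Section Localization.
Variables (D : idomainType) (P : Spec D).

Let F : D -> {fraction D} := @FracField.tofrac D.

Definition loc_pred : {pred {fraction D}} :=
  fun z => `[< exists a s : D, ~ val P s /\ z = F a / F s >].

Lemma loc_primeP : prime_ideal (val P).
Proof. exact/asboolP/(valP P). Qed.

Lemma loc_den_neq0 (s : D) : ~ val P s -> F s != 0.
Proof.
have [[P0 _ _] _ _] := loc_primeP.
by move=> nPs; rewrite tofrac_eq0; apply/eqP => s0; apply: nPs; rewrite s0.
Qed.

Lemma loc_denM (s t : D) : ~ val P s -> ~ val P t -> ~ val P (s * t).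
Proof. by have [_ _ PM] := loc_primeP; move=> Ps Pt /PM[]. Qed.

Lemma loc_subring_closed : subring_closed loc_pred.
Proof.
have [_ P1 _] := loc_primeP.
split.
- by apply/asboolP; exists 1, 1; rewrite /F rmorph1 divr1.
- move=> _ _ /asboolP[a [s [Ps ->]]] /asboolP[b [t [Pt ->]]]; apply/asboolP.
  exists (a * t - b * s), (s * t); split; first exact: loc_denM.
  by rewrite -mulNr addf_div ?loc_den_neq0 // /F rmorphB !rmorphM mulNr.
- move=> _ _ /asboolP[a [s [Ps ->]]] /asboolP[b [t [Pt ->]]]; apply/asboolP.
  exists (a * b), (s * t); split; first exact: loc_denM.
  by rewrite /F !rmorphM mulf_div.
Qed.

HB.instance Definition _ :=
  GRing.isSubringClosed.Build {fraction D} loc_pred loc_subring_closed.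

(* The localization of [D] at [P], as the subring of the fractions a / s
   with s outside P in the fraction field of [D]. *)
Record localization :=
  Localization { loc_val :> {fraction D}; _ : loc_val \in loc_pred }.

HB.instance Definition _ := [isSub for loc_val].
HB.instance Definition _ := [Choice of localization by <:].
HB.instance Definition _ := [SubChoice_isSubComNzRing of localization by <:].

(* [idomainType] requires a decidable unit predicate and a total inverse;
   both are obtained classically. *)
Definition loc_unit : {pred localization} :=
  fun x => `[< exists y : localization, y * x = 1 >].

Definition loc_inv (x : localization) : localization :=
  if pselect (exists y : localization, y * x = 1) is left e
  then projT1 (cid e) else x.

Lemma loc_mulVx : {in loc_unit, left_inverse 1 loc_inv *%R}.
Proof.
by move=> x /asboolP ux; rewrite /loc_inv; case: pselect => // e; case: cid.
Qed.

Lemma loc_unitPl (x y : localization) : y * x = 1 -> loc_unit x.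
Proof. by move=> yx; apply/asboolP; exists y. Qed.

Lemma loc_invr_out : {in [predC loc_unit], loc_inv =1 id}.
Proof.
by move=> x /asboolP ux; rewrite /loc_inv; case: pselect.
Qed.

HB.instance Definition _ :=
  GRing.ComNzRing_hasMulInverse.Build localization
    loc_mulVx loc_unitPl loc_invr_out.

Lemma loc_integral : GRing.integral_domain_axiom localization.
Proof.
move=> x y /(congr1 val) xy0; apply/orP.
have /eqP : val x * val y = 0 by exact: xy0.
by rewrite mulf_eq0 => /orP[] /eqP e; [left|right];
  apply/eqP/val_inj; rewrite e.
Qed.

HB.instance Definition _ :=
  GRing.ComUnitRing_isIntegral.Build localization loc_integral.

End Localization.

(* Finite sums of products, i.e. the product of ideals or of submodules. *)
Definition mul_set (R : comNzRingType) (A B : set R) : set R :=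
  [set z | exists s : seq (R * R),
     (forall p, p \in s -> A p.1 /\ B p.2) /\ z = \sum_(p <- s) p.1 * p.2].

Section MPD.
Variable D : idomainType.

Let F : D -> {fraction D} := @FracField.tofrac D.

Definition fractional_ideal (J : set {fraction D}) : Prop :=
  [/\ J 0, forall x y, J x -> J y -> J (x + y),
      forall a x, J x -> J (F a * x)
    & exists2 d : D, d != 0 & forall x, J x -> range F (F d * x)].

Definition invertible (I : set D) : Prop :=
  ideal I /\
  exists2 J, fractional_ideal J & mul_set (F @` I) J = range F.

Definition MNI (Q : set D) : Prop :=
  [/\ ideal Q, ~ invertible Q
    & forall I, ideal I -> ~ invertible I -> Q `<=` I -> I = Q].

Definition MPD : Prop :=
  exists Q, unique MNI Q /\
    forall I, ideal I -> I <> [set 0] -> ~ invertible I ->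
      exists2 J, invertible J & I = mul_set J Q.

Definition h_local : Prop :=
  (forall I : set D, ideal I -> I <> [set 0] ->
     finite_set [set M | maximal_ideal M /\ I `<=` M]) /\
  (forall P : set D, prime_ideal P -> P <> [set 0] ->
     exists! M, maximal_ideal M /\ P `<=` M).

End MPD.

(* By [maximal_prime], the elements of [Spec D] that are maximal ideals are
   all the maximal ideals of [D]. *)
Definition GMPD (D : idomainType) : Prop :=
  h_local D /\
  forall M : Spec D, maximal_ideal (val M) -> MPD (localization M).

(* Main.v *)
Require Import Defs.
From mathcomp Require Import all_boot all_order all_algebra.
From mathcomp Require Import boolp classical_sets functions cardinality.
From mathcomp Require Import fraction finmap zify ring.

(** The point is that a nonzero prime of a GMPD domain is comparable to at most
    one other nonzero prime.

    Locally, let R be a local domain with maximal ideal m, MPD with MNI ideal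
    Q. Invertible ideals of R are principal
    ([local_invertible_principal]), so every nonzero ideal is xR or xQ. A
    nonzero prime P that is not maximal cannot be principal
    ([principal_prime_maximal]), hence P = xQ; primality then forces P = Q
    ([pinched_prime]). So R has at most one prime strictly between 0 and m.

    Globally, extending primes to D_M is injective on the primes inside M, so
    below each maximal ideal M of D there is at most one prime other than 0
    and M ([MPD_below_uniq]). As h-locality puts a nonzero prime under a single
    maximal ideal, comparability is a matching on the nonzero primes
    ([GMPD_below_uniq], [GMPD_above_uniq]).

    A finite poset consisting of a least element and such a matching is
    determined by its number n of elements and its number l of matched pairs:
    [matching_spindle_enum] lists it in an order from which the relation can be
    read off from n and l alone. Since 1 + 2l <= n, there are at most
    ceil(n / 2) values of l, and l serves as the invariant of the theorem. *)

Set Implicit Arguments.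
Unset Strict Implicit.
Unset Printing Implicit Defensive.

Import Order.TTheory GRing.Theory.

(** * Posets made of a least element and a matching *)

(** The order on positions 0, ..., n - 1 whose only strict relations are
    0 < j and i < i + l for 1 <= i <= l: a least element, l chains of length
    two, and isolated points. *)
Definition spindle (l i j : nat) : bool :=
  [|| i == j, i == 0 | (0 < i <= l) && (j == i + l)].

Definition spindle_enum d (T : porderType d) (n l : nat) (s : seq T) : Prop :=
  [/\ uniq s, forall x, x \in s, size s = n &
      forall x y, (x <= y)%O = spindle l (index x s) (index y s)].

Lemma spindle_enum_iso d d' (T : porderType d) (U : porderType d') n l
    (s : seq T) (t : seq U) :
  spindle_enum n l s -> spindle_enum n l t -> poset_iso T U.
Proof.
move=> [us ms ns les] [ut mt nt let_].
case: n => [|n] in ns nt *.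
  (* Both posets are empty, and there is no default element for [nth]. *)
  have T0 (x : T) : False by have := ms x; rewrite (size0nil ns).
  have U0 (x : U) : False by have := mt x; rewrite (size0nil nt).
  exists (fun x => False_rect U (T0 x)), (fun x => False_rect T (U0 x)).
  by split=> x; [case: (T0 x)|case: (U0 x)|case: (T0 x)|case: (U0 x)].
case: s => [//|x0 s] in us ms ns les *.
case: t => [//|y0 t] in ut mt nt let_ *.
set s' := x0 :: s in us ms ns les *; set t' := y0 :: t in ut mt nt let_ *.
have ltT x : index x s' < n.+1 by rewrite -ns index_mem.
have ltU y : index y t' < n.+1 by rewrite -nt index_mem.
exists (fun x => nth y0 t' (index x s')), (fun y => nth x0 s' (index y t')).
split=> [x|y|x y|x y]; rewrite ?let_ ?les ?index_uniq ?ns ?nt //;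
  by rewrite nth_index.
Qed.

Section Matching.
Variables (d : Order.disp_t) (T : porderType d) (b : T).
Hypothesis bot_le : forall x, (b <= x)%O.
Hypothesis above_uniq :
  forall x y z, (b < x)%O -> (x < y)%O -> (x < z)%O -> y = z.
Hypothesis below_uniq :
  forall x y z, (b < x)%O -> (b < y)%O -> (x < z)%O -> (y < z)%O -> x = y.

(** The enumeration is: the least element, then the lower ends of the l matched
    pairs, then their upper ends in the same order, then everything else. *)
Lemma matching_spindle_enum (r : seq T) :
  uniq r -> (forall x, x \in r) ->
  exists2 l, l < uphalf (size r) & exists s : seq T, spindle_enum (size r) l s.
Proof.
move=> ur mr.
pose mid := [seq x <- r | (b < x)%O && has (fun y => (x < y)%O) r].
pose up x := nth b r (find (fun y => (x < y)%O) r).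
have midP x : reflect ((b < x)%O /\ exists y, (x < y)%O) (x \in mid).
  rewrite mem_filter mr andbT; apply: (iffP andP) => -[bx].
    by case/hasP=> y _ xy; split=> //; exists y.
  by case=> y xy; split=> //; apply/hasP; exists y.
have up_gt x : x \in mid -> (x < up x)%O.
  by rewrite mem_filter => /andP[/andP[_ h] _]; exact: nth_find.
have up_eq x y : (b < x)%O -> (x < y)%O -> up x = y.
  move=> bx xy; apply: (above_uniq bx _ xy).
  by apply/up_gt/midP; split=> //; exists y.
have b_mid : b \notin mid by apply/midP => -[]; rewrite ltxx.
have b_up : b \notin map up mid.
  by apply/mapP => -[x /up_gt xu bE]; move: (bot_le x); rewrite bE lt_geF.
pose s1 := b :: mid ++ map up mid.
have us1 : uniq s1.
  rewrite /= mem_cat negb_or b_mid b_up /= cat_uniq filter_uniq //=.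
  apply/andP; split.
    (* A chain b < x < up x < z would match z with both x and up x. *)
    apply/hasPn => _ /mapP[x xm ->]; apply/midP => -[bu [z uz]].
    have /midP[bx _] := xm; have xu := up_gt x xm.
    have := below_uniq bx bu (lt_trans xu uz) uz.
    by move=> xE; move: xu; rewrite -xE ltxx.
  rewrite map_inj_in_uniq ?filter_uniq // => x y xm ym xyE.
  have /midP[bx _] := xm; have /midP[by_ _] := ym.
  by apply: (below_uniq bx by_ (up_gt x xm)); rewrite xyE up_gt.
pose s := s1 ++ [seq x <- r | x \notin s1].
have us : uniq s.
  rewrite cat_uniq us1 filter_uniq // andbT /=.
  by apply/hasPn => x; rewrite mem_filter => /andP[].
have ms x : x \in s by rewrite mem_cat mem_filter mr andbT orbN.
have sE : size s = size r.
  by apply/perm_size/uniq_perm => // x; rewrite ms mr.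
have szl : (size mid).*2.+1 <= size r.
  by rewrite -sE size_cat /= size_cat size_map addnn leq_addr.
exists (size mid); first by rewrite uphalfE; lia.
exists s; split=> // x y.
have leE : (x <= y)%O = [|| x == y, x == b | (x \in mid) && (y == up x)].
  apply/idP/idP; last first.
    by case/or3P=> [/eqP->//|/eqP->//|/andP[xm /eqP->]]; exact/ltW/up_gt.
  rewrite le_eqVlt => /orP[->//|xy].
  case: (eqVneq x b) => [->|xb]; first by rewrite orbT.
  have bx : (b < x)%O by rewrite lt_neqAle eq_sym xb bot_le.
  have xm : x \in mid by apply/midP; split=> //; exists y.
  by rewrite xm (up_eq _ _ bx xy) eqxx !orbT.
have idx_eq z w : (index z s == index w s) = (z == w).
  apply/eqP/eqP => [e|-> //].
  by rewrite -[z](nth_index b (ms z)) e nth_index.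
have idx0 : (index x s == 0) = (x == b).
  by rewrite -(idx_eq x b) [index b s]/= eqxx.
rewrite leE /spindle idx_eq idx0; congr [|| _, _ | _].
have [->|xb] := eqVneq x b; first by rewrite (negPf b_mid) /= eqxx.
have sx : index x s =
    (index x (mid ++ map up mid ++ [seq x <- r | x \notin s1])).+1.
  by rewrite /s /= eq_sym (negPf xb) catA.
have xmE : (x \in mid) = (0 < index x s <= size mid).
  rewrite sx index_cat; case: (boolP (x \in mid)) => xm /=.
    by rewrite index_mem.
  by rewrite ltnNge leq_addr.
rewrite -xmE; case xm: (x \in mid); last by [].
rewrite andTb; have -> : up x = nth b s (index x s + size mid).
  have il : index x mid < size mid by rewrite index_mem.
  rewrite sx index_cat xm /s /= -catA nth_cat ltnNge leq_addl /= addnK nth_cat.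
  by rewrite size_map il (nth_map b) // nth_index.
have lts : index x s + size mid < size s.
  move: (xmE); rewrite xm => /esym/andP[_]; rewrite sE; lia.
apply/eqP/eqP => [->|<-]; first exact: index_uniq.
by rewrite nth_index.
Qed.

End Matching.

(** * Primes of a local MPD domain *)

Section UnitIdeal.
Local Open Scope classical_set_scope.
Local Open Scope ring_scope.

Lemma unit_ideal_invertible (R : idomainType) : invertible [set: R].
Proof.
split; first by [].
set F := @FracField.tofrac R.
exists (range F).
  split.
  - by exists 0 => //; exact: tofrac0.
  - by move=> _ _ [x _ <-] [y _ <-]; exists (x + y) => //; exact: tofracD.
  - by move=> a _ [x _ <-]; exists (a * x) => //; exact: tofracM.
  - exists 1; first exact: oner_neq0.
    by move=> _ [x _ <-]; exists x => //; rewrite tofrac1 mul1r.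
apply/seteqP; split=> [_ [s [sF ->]]|_ [x _ <-]].
  elim: s sF => [_|p s IHs sF].
    by rewrite big_nil; exists 0 => //; exact: tofrac0.
  have [|v _ vE] := IHs; first by move=> q qs; apply: sF; rewrite inE qs orbT.
  have [[i _ iE] [j _ jE]] := sF p (mem_head _ _).
  by exists (i * j + v) => //; rewrite big_cons -iE -jE -vE /F tofracD tofracM.
exists [:: (F x, 1)]; rewrite big_seq1 mulr1; split=> // p.
by rewrite inE => /eqP-> /=; split; [exists x|exists 1 => //; exact: tofrac1].
Qed.

End UnitIdeal.

Section LocalMPD.
Local Open Scope classical_set_scope.
Local Open Scope ring_scope.

Variables (R : idomainType) (m : set R).
Hypotheses (idm : ideal m) (m1 : ~ m 1).
Hypothesis unit_out : forall x, ~ m x -> exists y, y * x = 1.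

(** Write 1 as a sum of products i j with i in I and j in J, the inverse of I.
    All these products lie in R, and since R is local one of them is a unit;
    the corresponding i generates I. *)
Lemma local_invertible_principal (I : set R) :
  invertible I -> exists2 x, I x & forall t, I t -> exists a, t = a * x.
Proof.
have [m0 mD _] := idm.
case=> -[_ _ _] [J _ IJ].
set F := @FracField.tofrac R in IJ.
have Finj : injective F by move=> x y /eqP; rewrite tofrac_eq => /eqP.
have prodR i j : I i -> J j -> exists v, F v = F i * j.
  move=> Ii Jj; have : mul_set (F @` I) J (F i * j).
    exists [:: (F i, j)]; rewrite big_seq1; split=> // p.
    by rewrite inE => /eqP->; split=> //; exists i.
  by rewrite IJ => -[v _ <-]; exists v.
have [[i [j [u [Ii Jj nmu ijE]]]]|no_unit] :=
  pselect (exists i j u, [/\ I i, J j, ~ m u & F u = F i * j]).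
  have [w wu] := unit_out nmu; exists i => // t It.
  have [v vE] := prodR t j It Jj; exists (w * v); apply: Finj.
  have FM x y : F (x * y) = F x * F y by exact: tofracM.
  rewrite -[t in F t]mul1r -wu !FM ijE vE; ring.
have : mul_set (F @` I) J 1 by rewrite IJ; exists 1 => //; exact: tofrac1.
case=> s [sIJ s1]; case: m1.
suff [v mv vE] : exists2 v, m v & F v = \sum_(p <- s) p.1 * p.2.
  by rewrite -s1 -[1](@tofrac1 R) in vE; rewrite -(Finj _ _ vE).
elim: s sIJ {s1} => [_|p s IHs sIJ].
  by exists 0 => //; rewrite big_nil; exact: tofrac0.
have [|v mv vE] := IHs; first by move=> q qs; apply: sIJ; rewrite inE qs orbT.
have [[i Ii iE] Jp] := sIJ p (mem_head _ _).
have [u uE] := prodR i p.2 Ii Jp.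
exists (u + v); last by rewrite big_cons -vE -iE -uE; exact: tofracD.
apply: mD => //; apply: contrapT => nmu; apply: no_unit.
by exists i, p.2, u.
Qed.

Section PinchedPrime.
Variable Q : set R.
Hypotheses (idQ : ideal Q) (Q1 : ~ Q 1).
Hypothesis dichotomy : forall I, ideal I -> I <> [set 0] ->
  exists x, I = [set a * x | a in setT] \/ I = [set x * q | q in Q].

(** Suppose that P = (x) and that y is in m but not in P. The ideal (x, y) is
    not principal, and if it is gQ then primality of P makes g a unit, so
    (x, y) = Q. The same holds with y^2 in place of y, so y is in (x, y^2):
    y (1 - b y) is a multiple of x for some b. As 1 - b y is a unit, y is in
    P. *)
Lemma principal_prime_maximal (P : set R) (x : R) :
  prime_ideal P -> x != 0 -> P = [set a * x | a in setT] -> m `<=` P.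
Proof.
move=> [[P0 PD PM] P1 Pprime] x0 PE y my; apply: contrapT => nPy.
have [m0 mD mM] := idm.
have Px : P x by rewrite PE; exists 1 => //; rewrite mul1r.
have key z : m z -> ~ P z ->
    Q = [set w | exists a b, w = a * x + b * z].
  move=> mz nPz; set I := [set w | _].
  have idI : ideal I.
    split; first by exists 0, 0; ring.
      move=> _ _ [a [b ->]] [a' [b' ->]]; exists (a + a'), (b + b'); ring.
    by move=> c _ [a [b ->]]; exists (c * a), (c * b); ring.
  have Ix : I x by exists 1, 0; ring.
  have Iz : I z by exists 0, 1; ring.
  have I0 : I <> [set 0] by move=> I0; move: Ix; rewrite I0 => /eqP; exact/negP.
  have [g [IE|IE]] := dichotomy idI I0.
    (* If (x, z) = (g), then x = r g puts r in P = (x), making g a unit. *)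
    have := Ix; rewrite IE => -[r _ xE].
    have nPg : ~ P g.
      by move=> Pg; apply: nPz; move: Iz; rewrite IE => -[b _ <-]; exact: PM.
    have [|Pr|//] := Pprime r g; first by rewrite xE.
    move: Pr; rewrite PE => -[s _ rE].
    have sg : s * g = 1.
      by apply: (mulIf x0); rewrite mul1r -[in RHS]xE -rE; ring.
    have [a [b gE]] : I g by rewrite IE; exists 1 => //; rewrite mul1r.
    case: m1; rewrite -sg; apply: (mM s); rewrite gE.
    have mx : m x.
      apply: contrapT => /unit_out[u ux]; apply: P1; rewrite -ux; exact: PM.
    by apply: mD; exact: mM.
  have nPg : ~ P g.
    move=> Pg; apply: nPz; move: Iz; rewrite IE => -[q _ <-].
    by rewrite mulrC; exact: PM.
  have := Ix; rewrite IE => -[q Qq xE].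
  have [|//|Pq] := Pprime g q; first by rewrite xE.
  move: Pq; rewrite PE => -[s _ qE].
  have gs : g * s = 1.
    by apply: (mulIf x0); rewrite mul1r -[in RHS]xE -qE; ring.
  have [_ _ QM] := idQ.
  apply/seteqP; split=> [w Qw|_ [w Qw <-]]; last exact: QM.
  by exists (s * w); [exact: QM | rewrite mulrA gs mul1r].
have nPy2 : ~ P (y * y) by case/Pprime.
have : Q y by rewrite (key y my nPy); exists 0, 1; ring.
rewrite (key (y * y) (mM _ _ my) nPy2) => -[a [b yE]].
have [u uE] : exists u, u * (1 - b * y) = 1.
  apply: unit_out => mby; apply: m1.
  by rewrite -[1](subrK (b * y)); apply: mD => //; exact: mM.
have axE : a * x = (1 - b * y) * y.
  by apply: (addIr (b * (y * y))); rewrite -yE; ring.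
apply: nPy; have -> : y = (u * a) * x; last exact: PM.
by rewrite -mulrA axE mulrA uE mul1r.
Qed.

(** Once P = xQ, the generator x lies outside P, as otherwise x = xq with q in
    Q would give 1 in Q. Primality turns xQ = P into Q contained in P, and P is
    contained in Q because xQ is. *)
Lemma pinched_prime (P : set R) :
  prime_ideal P -> P <> [set 0] -> ~ m `<=` P -> P = Q.
Proof.
move=> Pp P0 nmP; have [idP P1 Pprime] := Pp.
have [x PE] := dichotomy idP P0.
have x0 : x != 0.
  apply/eqP => x0; apply: P0; rewrite x0 in PE.
  apply/seteqP; split=> [y|_ ->]; last by case: idP.
  by case: PE => -> [a _ <-]; rewrite ?mulr0 ?mul0r.
case: PE => PE; first by case: nmP; exact: principal_prime_maximal x0 PE.
have nPx : ~ P x.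
  rewrite PE => -[q Qq] xqE; apply: Q1.
  suff <- : q = 1 by [].
  by apply: (mulfI x0); rewrite mulr1.
have [_ _ QM] := idQ.
apply/seteqP; split=> [y|q Qq]; first by rewrite PE => -[q Qq <-]; exact: QM.
by have [|//|//] := Pprime x q; rewrite PE; exists q.
Qed.

End PinchedPrime.

Lemma local_MPD_middle_prime : MPD R -> exists Q, forall P : set R,
  prime_ideal P -> P <> [set 0] -> ~ m `<=` P -> P = Q.
Proof.
case=> Q [[[idQ nQ _] _] QP]; exists Q.
have [_ _ QM] := idQ; have [_ QD _] := idQ.
apply: pinched_prime => // [Q1|I idI I0].
  suff QT : Q = setT by apply: nQ; rewrite QT; exact: unit_ideal_invertible.
  by apply/seteqP; split=> // x _; rewrite -[x]mulr1; exact: QM.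
have [_ _ IM] := idI.
have [/local_invertible_principal[x Ix xP]|nI] := pselect (invertible I).
  exists x; left.
  apply/seteqP; split=> [t /xP[a ->]|_ [a _ <-]]; last exact: IM.
  by exists a.
have [J invJ ->] := QP I idI I0 nI.
have [x Jx xP] := local_invertible_principal invJ.
exists x; right; apply/seteqP; split=> [_ [s [sJQ ->]]|_ [q Qq <-]]; last first.
  exists [:: (x, q)]; rewrite big_seq1; split=> // p.
  by rewrite inE => /eqP->.
elim: s sJQ => [_|p s IHs sJQ].
  by rewrite big_nil; exists 0; [case: idQ|rewrite mulr0].
have [|q Qq qE] := IHs; first by move=> t ts; apply: sJQ; rewrite inE ts orbT.
have [/xP[a pE] Qp] := sJQ p (mem_head _ _).
exists (a * p.2 + q); first by apply: QD => //; exact: QM.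
by rewrite big_cons -qE pE; ring.
Qed.

End LocalMPD.

(** * Extension of primes to a localization *)

Section Extension.
Local Open Scope classical_set_scope.
Local Open Scope ring_scope.

Variables (D : idomainType) (M : Spec D).
Local Notation F := (@FracField.tofrac D).

Definition extension (P : set D) : set (localization M) :=
  [set z | exists a s, [/\ P a, ~ val M s & val z = F a / F s]].

Let prM : prime_ideal (val M) := loc_primeP M.

Lemma localization_mem a s : ~ val M s -> F a / F s \in loc_pred M.
Proof. by move=> nMs; apply/asboolP; exists a, s. Qed.

Lemma localizationP (z : localization M) :
  exists a s, ~ val M s /\ val z = F a / F s.
Proof. exact/asboolP/(valP z). Qed.

Lemma frac_eqP (a b s t : D) : ~ val M s -> ~ val M t ->
  F a / F s = F b / F t <-> a * t = b * s.
Proof.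
move=> nMs nMt.
have s0 : F s != 0 by exact: loc_den_neq0 nMs.
have t0 : F t != 0 by exact: loc_den_neq0 nMt.
rewrite (rwP eqP) eqr_div // -!tofracM tofrac_eq.
by split=> /eqP.
Qed.

(** Membership in the extension of P does not depend on the fraction chosen,
    because denominators lie outside M, hence outside P. *)
Lemma extension_fracE (P : Spec D) (z : localization M) a s :
  val P `<=` val M -> ~ val M s -> val z = F a / F s ->
  extension (val P) z <-> val P a.
Proof.
move=> PM nMs zE; split=> [[b [t [Pb nMt]]]|Pa]; last by exists a, s.
rewrite zE => /(frac_eqP _ _ nMs nMt) e.
have [[_ _ Pmul] _ Pprime] := loc_primeP P.
have [|//|/PM//] := Pprime a t.
by rewrite e mulrC; exact: Pmul.
Qed.

Lemma extension_prime (P : Spec D) :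
  val P `<=` val M -> prime_ideal (extension (val P)).
Proof.
move=> PM; have [[P0 PD Pmul] P1 Pprime] := loc_primeP P.
have [_ M1 _] := prM.
have FM x y : F (x * y) = F x * F y by exact: tofracM.
have mulE (x y : localization M) a b s t : ~ val M s -> ~ val M t ->
    val x = F a / F s -> val y = F b / F t ->
    val (x * y) = F (a * b) / F (s * t).
  by move=> nMs nMt xE yE; rewrite rmorphM /= xE yE mulf_div !FM.
split=> [|/(extension_fracE PM M1) e|x y xyP].
- split.
  + by exists 0, 1; split=> //; rewrite rmorph0 [F 0]tofrac0 mul0r.
  + move=> x y [a [s [Pa nMs xE]]] [b [t [Pb nMt yE]]].
    exists (a * t + b * s), (s * t); split; last 2 first.
    * exact: loc_denM.
    * rewrite rmorphD /= xE yE addf_div; first last.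
      - exact: loc_den_neq0 nMt.
      - exact: loc_den_neq0 nMs.
      by rewrite tofracD !tofracM.
    * by apply: PD; rewrite mulrC; exact: Pmul.
  + move=> x y [b [t [Pb nMt yE]]]; have [a [s [nMs xE]]] := localizationP x.
    exists (a * b), (s * t); split; [exact: Pmul|exact: loc_denM|exact: mulE].
- by apply: P1; apply/e; rewrite rmorph1 [F 1]tofrac1 divr1.
have [a [s [nMs xE]]] := localizationP x.
have [b [t [nMt yE]]] := localizationP y.
have xyE := mulE _ _ _ _ _ _ nMs nMt xE yE.
move: xyP => /(extension_fracE PM (loc_denM nMs nMt) xyE).
by case/Pprime=> ?; [left; exists a, s|right; exists b, t].
Qed.

Lemma extension_tofrac (P : Spec D) a (h : F a / F 1 \in loc_pred M) :
  val P `<=` val M -> extension (val P) (Localization h) <-> val P a.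
Proof.
have [_ M1 _] := prM.
by move=> PM; exact: (extension_fracE PM M1).
Qed.

(** P is recovered from its extension by contraction, so extension reflects
    inclusion. *)
Lemma extension_le (P P' : Spec D) : val P `<=` val M -> val P' `<=` val M ->
  extension (val P) `<=` extension (val P') -> (P <= P')%O.
Proof.
have [_ M1 _] := prM.
move=> PM P'M PP'; rewrite le_specE => a Pa.
have h := localization_mem a M1.
by apply/(extension_tofrac h P'M)/PP'/(extension_tofrac h PM).
Qed.

Lemma localization_unit (z : localization M) :
  ~ extension (val M) z -> exists y, y * z = 1.
Proof.
have [a [s [nMs zE]]] := localizationP z.
move/(extension_fracE (@subset_refl _ _) nMs zE) => nMa.
exists (Localization (localization_mem s nMa)); apply: val_inj.
rewrite rmorphM rmorph1 /= zE mulf_div [F a * F s]mulrC divff //.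
by rewrite mulf_neq0 ?(loc_den_neq0 nMs) ?(loc_den_neq0 nMa).
Qed.

End Extension.

Arguments extension {D} M P z.

(** * The spectrum of a GMPD domain *)

Section Spectrum.
Local Open Scope classical_set_scope.
Local Open Scope ring_scope.

Lemma zero_prime (D : idomainType) : prime_ideal [set 0 : D].
Proof.
split=> [||x y /= /eqP].
- by split=> // [x y -> ->|a x ->] /=; rewrite ?addr0 ?mulr0.
- by move=> /eqP; rewrite oner_eq0.
- by rewrite mulf_eq0 => /orP[] /eqP; [left|right].
Qed.

Definition zero_spec (D : idomainType) : Spec D :=
  SpecOf (asboolT (@zero_prime D)).

Lemma zero_spec_le (D : idomainType) (P : Spec D) : (zero_spec D <= P)%O.
Proof. by rewrite le_specE => _ ->; have [[]] := loc_primeP P. Qed.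

Lemma zero_spec_lt (D : idomainType) (P : Spec D) :
  (zero_spec D < P)%O -> val P <> [set 0].
Proof.
move=> ltP PE; move: ltP; rewrite (_ : P = zero_spec D) ?ltxx //.
exact: val_inj.
Qed.

(** A prime strictly between 0 and M extends to a nonzero prime that is not
    maximal in D_M, and there is only one such prime. *)
Lemma MPD_below_uniq (D : idomainType) (M x y z w : Spec D) :
  MPD (localization M) -> (zero_spec D < x)%O -> (zero_spec D < y)%O ->
  (x < z)%O -> (z <= M)%O -> (y < w)%O -> (w <= M)%O -> x = y.
Proof.
move=> MM x0 y0 xz zM yw wM.
have eMp : prime_ideal (extension M (val M)) by exact: extension_prime.
have [eM_ideal eM1 _] := eMp.
have [Q QP] := local_MPD_middle_prime eM_ideal eM1 (@localization_unit _ M) MM.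
suff extQ (u v : Spec D) : (zero_spec D < u)%O -> (u < v)%O -> (v <= M)%O ->
    val u `<=` val M /\ extension M (val u) = Q.
  have [xM xQ] := extQ x z x0 xz zM; have [yM yQ] := extQ y w y0 yw wM.
  apply/le_anti/andP; split; apply: (@extension_le _ M) => //;
  by rewrite xQ yQ.
move=> u0 uv vM.
have uM : val u `<=` val M.
  by rewrite -(le_specE u M); exact/ltW/(lt_le_trans uv).
have zeroM : val (zero_spec D) `<=` val M by rewrite -le_specE zero_spec_le.
have [[ext0 _ _] _ _] := extension_prime zeroM.
split=> //; apply: QP; first exact: extension_prime.
  move=> u_ext0; suff /(lt_le_trans u0) : (u <= zero_spec D)%O by rewrite ltxx.
  by apply: (@extension_le _ M) => //; rewrite u_ext0 => _ ->.
move=> /(extension_le (@subset_refl _ _) uM) Mu.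
by move: (lt_le_trans uv (le_trans vM Mu)); rewrite ltxx.
Qed.

Section GMPDSpec.
Variable D : idomainType.
Hypothesis gD : GMPD D.

Lemma GMPD_maximal_above (P : Spec D) : (zero_spec D < P)%O ->
  exists M : Spec D, [/\ maximal_ideal (val M), (P <= M)%O &
    forall N : Spec D, maximal_ideal (val N) -> (P <= N)%O -> N = M].
Proof.
have [[_ hloc] _] := gD.
move=> /zero_spec_lt P0; have [M [[maxM PM] Muniq]] := hloc _ (loc_primeP P) P0.
exists (SpecOf (asboolT (maximal_prime maxM))); split=> //.
  by rewrite le_specE.
move=> N maxN; rewrite le_specE => PN; apply: val_inj.
by rewrite -(Muniq (val N)).
Qed.

Lemma GMPD_below_uniq (x y z : Spec D) : (zero_spec D < x)%O ->
  (zero_spec D < y)%O -> (x < z)%O -> (y < z)%O -> x = y.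
Proof.
move=> x0 y0 xz yz; have [M [maxM zM _]] := GMPD_maximal_above (lt_trans x0 xz).
exact: (MPD_below_uniq (gD.2 _ maxM) x0 y0 xz zM yz zM).
Qed.

(** Anything strictly above the nonzero prime x equals the unique maximal ideal
    M over x: a prime w strictly between x and M would share the upper bound M
    with x. *)
Lemma GMPD_above_uniq (x y z : Spec D) : (zero_spec D < x)%O ->
  (x < y)%O -> (x < z)%O -> y = z.
Proof.
move=> x0.
have [M [maxM xM Muniq]] := GMPD_maximal_above x0.
suff eqM w : (x < w)%O -> w = M by move=> /eqM-> /eqM->.
move=> xw; have w0 := lt_trans x0 xw.
have [N [maxN wN _]] := GMPD_maximal_above w0.
have NM : N = M by apply: Muniq => //; exact/ltW/(lt_le_trans xw).
move: wN; rewrite NM le_eqVlt => /orP[/eqP//|wM].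
have xwE := GMPD_below_uniq x0 w0 (lt_trans xw wM) wM.
by move: xw; rewrite xwE ltxx.
Qed.

Lemma GMPD_spindle_enum n : ([set: Spec D] #= `I_n)%card ->
  exists2 l, (l < uphalf n)%N & exists s : seq (Spec D), spindle_enum n l s.
Proof.
move=> Dn; have <- := card_fset_set Dn.
apply: (matching_spindle_enum (@zero_spec_le D)).
- exact: GMPD_above_uniq.
- exact: GMPD_below_uniq.
- exact: fset_uniq.
move=> x; have Dfin : finite_set [set: Spec D] by apply/finite_setP; exists n.
by rewrite in_fset_set // in_setT.
Qed.

End GMPDSpec.

End Spectrum.

Theorem proposition12 (n : nat) (hn : 1 <= n) :
  exists c : idomainType -> 'I_(uphalf n),
    forall D E : idomainType,
      GMPD D -> ([set: Spec D]%classic #= `I_n)%card ->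
      GMPD E -> ([set: Spec E]%classic #= `I_n)%card ->
      c D = c E -> poset_iso (Spec D) (Spec E).
Proof.
have half_gt0 : (0 < uphalf n)%N by case: n hn.
have ex_l (D : idomainType) : exists l : 'I_(uphalf n),
    GMPD D -> ([set: Spec D]%classic #= `I_n)%card ->
    exists s : seq (Spec D), spindle_enum n l s.
  have [[gD Dn]|bad] :=
    pselect (GMPD D /\ ([set: Spec D]%classic #= `I_n)%card).
    by have [l ltl sP] := GMPD_spindle_enum gD Dn; exists (Ordinal ltl).
  (* For any other domain the value of the invariant is arbitrary. *)
  by exists (Ordinal half_gt0) => gD Dn; case: bad.
exists (fun D => projT1 (cid (ex_l D))) => D E gD Dn gE En.
case: (cid (ex_l D)) => l lP; case: (cid (ex_l E)) => l' l'P /= ll'.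
have [s sP] := lP gD Dn; have [t tP] := l'P gE En.
by rewrite -ll' in tP; exact: spindle_enum_iso sP tP.
Qed.
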